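(* Let $(\mathsf X,d)$ be a Polish space and let $\phi:\mathscr P_1(\mathsf X)\to\bar{\mathbb R}$ be a proper convex function on $(\mathscr P_1(\mathsf X),W_1)$, i.e. $\phi$ is convex and lower semicontinuous with respect to $W_1$, $\phi(\mu)>-\infty$ for all $\mu$, and $\phi(\mu_0)\in\mathbb R$ for some $\mu_0$. Let $\rho(f):=\sup_{\mu\in\mathscr P_1(\mathsf X)}\left(\int f\,d\mu-\phi(\mu)\right)$. Let $\Phi:\mathbb R\to\mathbb R$ be an increasing convex function with $\Phi(0)=0$, and let $\Phi^*(s)=\sup_{t\in\mathbb R}\{st-\Phi(t)\}$ be its Legendre dual. Let $\nu\in\mathscr P_1(\mathsf X)$. Then the following are equivalent: (1) $\Phi(W_1(\mu,\nu))\le\phi(\mu)$ for all $\mu\in\mathscr P_1(\mathsf X)$; (2) $\rho\left(t\int_{\mathsf X} f\,d\nu-tf-\Phi^*(t)\right)\le 0$ for all $f\in[\mathscr L(\mathsf X)]_1$ and all $t\in\mathbb R$.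
   Context: A Polish space $(\mathsf X,d)$ is a complete separable metric space. $\bar{\mathbb R}=[-\infty,+\infty]$. $\mathscr P_1(\mathsf X)$ is the set of Borel probability measures $\mu$ on $\mathsf X$ with $\int d(x_0,x)\,\mu(dx)<\infty$ for an arbitrary $x_0\in\mathsf X$. $W_1(\mu,\nu)=\inf\{\mathbb E[d(X,Y)]:\mathrm{law}(X)=\mu,\ \mathrm{law}(Y)=\nu\}$. $\mathscr L(\mathsf X)$ is the space of real-valued Lipschitz functions on $\mathsf X$, $\|f\|_{\mathrm{Lip}}=\sup_{x\ne y}|f(x)-f(y)|/d(x,y)$, and $[\mathscr L(\mathsf X)]_1=\{f\in\mathscr L(\mathsf X):\|f\|_{\mathrm{Lip}}\le1\}$. Convention: for those $t$ with $\Phi^*(t)=+\infty$, the argument of $\rho$ in (2) is the constant $-\infty$, $\rho$ of it equals $-\infty$ by the defining formula, and the inequality in (2) holds trivially. *)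

(* Defs.v *)
From HB Require Import structures.
From mathcomp Require Import all_boot all_order all_algebra.
From mathcomp Require Import all_classical all_reals all_analysis measurable_realfun.
Set Implicit Arguments.
Unset Strict Implicit.
Unset Printing Implicit Defensive.
Import Order.TTheory GRing.Theory Num.Theory.
Import numFieldNormedType.Exports.
Local Open Scope classical_set_scope.
Local Open Scope ring_scope.

(* A Polish space, in the sense of a complete separable metric space, is an
   [X : completeMetricType R] with [separable X]. These types are pointed, hence
   nonempty; the empty space carries no probability measure. *)
#[short(type="completeMetricType")]
HB.structure Definition CompleteMetric (R : numDomainType) :=
  {T of CompletePseudoMetric R T & Metric R T}.

Definition separable (T : topologicalType) :=
  exists2 S : set T, countable S & dense S.

(* [X] equipped with its Borel sigma-algebra. *)
Notation borel X := (g_sigma_algebraType (@open X)).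

Section first_moment.
Context {R : realType} {X : completeMetricType R}.
Local Open Scope ereal_scope.

Lemma measurable_mdist (x0 : X) :
  measurable_fun [set: borel X] (mdist x0 : borel X -> R).
Proof.
apply: (measurability _ (RGenOpens.measurableE R)) => //.
move=> _ [_ [a [b ->]] <-]; rewrite setTI; apply: sub_sigma_algebra => /=.
rewrite openE => x /=; rewrite in_itv/= => /andP[ax xb].
rewrite /interior -metricType_numDomainType.filter_from_mdist_nbhs.
pose e := Num.min (mdist x0 x - a)%R (b - mdist x0 x)%R.
exists e; first by rewrite /= lt_min !subr_gt0 ax.
move=> y /=; rewrite lt_min => /andP[h1 h2].
rewrite in_itv/=; apply/andP; split.
  have := metric_triangle x0 y x; rewrite (metric_sym y x) => h.
  by rewrite -(ltrD2r (mdist x y)) (lt_le_trans _ h)// -ltrBrDl.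
by rewrite (le_lt_trans (metric_triangle x0 x y))// -ltrBrDl.
Qed.

Definition finite_first_moment (mu : set (borel X) -> \bar R) :=
  forall x0 : X, \int[mu]_x (mdist x0 x)%:E < +oo.

End first_moment.

(* Two elements of [P1 X] that agree on the Borel sets may differ as Rocq
   functions on non-measurable sets. They are at [W1]-distance 0 (defined below),
   so a lower semicontinuous function on [P1 X] does not separate them. *)
Record P1 (R : realType) (X : completeMetricType R) := mkP1 {
  P1_prob :> probability (borel X) R ;
  P1_moment : finite_first_moment P1_prob }.

HB.instance Definition _ (R : realType) (X : completeMetricType R) :=
  gen_eqMixin (P1 X).
HB.instance Definition _ (R : realType) (X : completeMetricType R) :=
  gen_choiceMixin (P1 X).

Section mixture.
Context {R : realType} {X : completeMetricType R}.
Local Open Scope ereal_scope.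
Variables (t : {i01 R}) (mu nu : P1 X).

Definition mix_measure : set (borel X) -> \bar R :=
  measure_add (mscale (t%:num%:nng)%R mu)
              (mscale ((1 - t%:num)%:nng)%R nu).

HB.instance Definition _ := Measure.on mix_measure.

Lemma mix_measureE A :
  mix_measure A = t%:num%:E * mu A + (1 - t%:num)%:E * nu A.
Proof. by rewrite /mix_measure measure_addE. Qed.

Let mix_setT : mix_measure setT = 1.
Proof.
by rewrite mix_measureE !probability_setT !mule1 -EFinD addrC subrK.
Qed.

HB.instance Definition _ := Measure_isProbability.Build _ _ _
  mix_measure mix_setT.

Let mix_moment : finite_first_moment mix_measure.
Proof.
move=> x0; have d0 (x : borel X) : 0 <= (mdist x0 x)%:E.
  by rewrite lee_fin mdist_ge0.
have md : measurable_fun [set: borel X]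
    (fun x : borel X => (mdist x0 (x : X))%:E : \bar R).
  by apply/measurable_EFinP; exact: measurable_mdist.
rewrite ge0_integral_measure_add//= !ge0_integral_mscale//=.
have fin (m : P1 X) : \int[m]_x (mdist x0 x)%:E \is a fin_num.
  by rewrite ge0_fin_numE ?P1_moment// integral_ge0.
by rewrite lte_add_pinfty// ltey_eq fin_numM.
Qed.

Definition mix : P1 X := mkP1 mix_moment.

End mixture.

Section Wasserstein.
Context {R : realType} {X : completeMetricType R}.
Local Open Scope ereal_scope.

Definition has_law d (Omega : measurableType d) (P : probability Omega R)
    (Y : {RV P >-> borel X}) (mu : P1 X) :=
  forall A, measurable A -> distribution P Y A = mu A.

(* Finite on [P1 X]: the product coupling has finite cost. *)
Definition W1 (mu nu : P1 X) : \bar R :=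
  ereal_inf [set c | exists d (Omega : measurableType d)
      (P : probability Omega R) (Y Z : {RV P >-> borel X}),
    [/\ has_law Y mu, has_law Z nu &
        c = 'E_P[fun w => mdist (Y w : X) (Z w : X)] ]].

Definition W1_open (U : set (P1 X)) :=
  forall mu, U mu -> exists2 e : R, (0 < e)%R &
    forall nu, W1 mu nu < e%:E -> U nu.

Let W1_openT : W1_open setT.
Proof. by move=> mu _; exists 1%R. Qed.

Let W1_openI : setI_closed W1_open.
Proof.
move=> U V oU oV mu [/oU[e e0 He] /oV[e' e'0 He']].
exists (Num.min e e'); first by rewrite lt_min e0.
by move=> nu h; split; [apply: He|apply: He']; apply: (lt_le_trans h);
  rewrite lee_fin ge_min lexx ?orbT.
Qed.

Let W1_open_bigU I (U : I -> set (P1 X)) :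
  (forall i, W1_open (U i)) -> W1_open (\bigcup_i U i).
Proof.
move=> oU mu [i _ /oU[e e0 He]]; exists e => // nu /He Unu; by exists i.
Qed.

(* The topology of [P1 X] is the metric topology of [W1]. *)
HB.instance Definition _ :=
  isOpenTopological.Build (P1 X) W1_openT W1_openI W1_open_bigU.

End Wasserstein.

Section functionals.
Context {R : realType} {X : completeMetricType R}.
Local Open Scope ereal_scope.

Definition convex_P1 (phi : P1 X -> \bar R) :=
  forall (t : {i01 R}) (mu nu : P1 X),
    phi (mix t mu nu) <= t%:num%:E * phi mu + (1 - t%:num)%:E * phi nu.

Definition proper_convex (phi : P1 X -> \bar R) :=
  [/\ convex_P1 phi, lower_semicontinuous phi,
      forall mu, -oo < phi mu & exists mu0, phi mu0 \is a fin_num].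

(* [+oo - +oo] is [-oo] here. It does not arise below: [rho] is applied to
   Lipschitz functions, which are integrable for every [mu], and to the constant
   [-oo], for which every term of the supremum is [-oo] as [-oo < phi mu]. *)
Definition rho (phi : P1 X -> \bar R) (f : X -> \bar R) : \bar R :=
  ereal_sup (range (fun mu : P1 X => \int[mu]_x f x - phi mu)).

Definition Lipschitz : set (X -> R) :=
  [set f | exists K : R, forall x y, (`|f x - f y| <= K * mdist x y)%R].

(* On a one-point space this supremum is [-oo] instead of 0, which does not
   change the unit ball. *)
Definition Lip_norm (f : X -> R) : \bar R :=
  ereal_sup [set c | exists x y,
    x != y /\ c = (`|f x - f y| / mdist x y)%:E].

Definition Lipschitz1 : set (X -> R) :=
  Lipschitz `&` [set f | Lip_norm f <= 1].

End functionals.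

Definition legendre (R : realType) (Phi : R -> R) (s : R) : \bar R :=
  ereal_sup (range (fun t : R => (s * t - Phi t)%:E)).

(* Main.v *)
Require Import Defs.
From HB Require Import structures.
From mathcomp Require Import all_boot all_order all_algebra.
From mathcomp Require Import all_classical all_reals all_analysis.
From mathcomp Require Import measurable_realfun ring lra.
Set Implicit Arguments.
Unset Strict Implicit.
Unset Printing Implicit Defensive.
Import Order.TTheory GRing.Theory Num.Theory.
Import numFieldNormedType.Exports.
Local Open Scope classical_set_scope.
Local Open Scope ring_scope.

(** For a 1-Lipschitz [f] write [z f mu] for the gain
    [\int f dnu - \int f dmu]. Integrating the argument of [rho] against [mu]
    shows that the inequality on [rho] says
    [t * z f mu - legendre Phi t <= phi mu] for all [f], [t] and [mu]
    ([rho_le0P]). The Kantorovich-Rubinstein duality says that [W1 mu nu] is the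
    supremum of [z f mu] over [f].

    The bound on [phi] implies the bound on [rho]: by Fenchel-Young the left-hand
    side is at most [Phi (z f mu)], hence at most [Phi (W1 mu nu)], because
    [z f mu <= W1 mu nu] ([Lipschitz1_gap_le_W1]) and [Phi] is nondecreasing.

    Conversely, given [mu], let [t] be the slope of a supporting line of [Phi] at
    [w = W1 mu nu] ([convex_subgradient]); it is nonnegative, and
    [legendre Phi t = t * w - Phi w]. So the inequality on [rho] bounds
    [t * z f mu] by [phi mu + t * w - Phi w] uniformly in [f]. By the duality
    [t * w] has the same bound, which is [Phi w <= phi mu].

    The duality ([W1_le_Lipschitz1_gap]) is reduced to a finite transport problem.
    Sending each point of the space to the nearest among the first points of a
    dense sequence moves both measures at an arbitrarily small cost
    ([cvg_integral_nearest]). Linear programming duality for the discretised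
    masses, obtained from Farkas' lemma ([farkas], [transport_duality]), gives
    either a cheap transport plan or a pair of potentials, which extends to a
    Lipschitz function on the whole space ([inf_convolution_potential]). The plan
    is realised by a coupling of the original measures that is a multiple of their
    product on each pair of cells ([cell_coupling_probability]). An infimum over
    couplings only has to be approached, so no optimal coupling is constructed. *)

(** * Linear programming duality for finite transport problems *)

Lemma scalar0 (R : pzRingType) (W : lmodType R) (f : W -> R) :
  scalar f -> f 0 = 0.
Proof.
by move=> fl; have := fl (-1) 0 0; rewrite scaler0 addr0 mulN1r addNr.
Qed.

(** Induction on the number of functionals, after Bartl. If [alpha i] is not
    already redundant, some [y] satisfies all the other constraints and violates
    [gamma y <= 0]; then [alpha i y > 0]. Projecting along [y] onto the kernel
    of [alpha i] removes the constraint [alpha i], and the coefficient that it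
    gets when the projection is undone is nonnegative by the choice of [y]. *)
Lemma farkas (R : realFieldType) (W : lmodType R) (I : eqType) (s : seq I)
    (alpha : I -> W -> R) (gamma : W -> R) :
  uniq s -> (forall i, scalar (alpha i)) -> scalar gamma ->
  (forall x, (forall i, i \in s -> alpha i x <= 0) -> gamma x <= 0) ->
  exists2 u : I -> R, (forall i, 0 <= u i) &
    forall x, gamma x = \sum_(i <- s) u i * alpha i x.
Proof.
elim: s alpha gamma => [|i s IH] alpha gamma /=.
  move=> _ _ gl g_le0; exists (fun=> 0) => // x; rewrite big_nil.
  apply/eqP; rewrite eq_le g_le0//=.
  have := gl (-1) x 0; rewrite addr0 (scalar0 gl) addr0 scaleN1r mulN1r => gN.
  by rewrite -oppr_le0 -gN g_le0.
move=> /andP[iNs us] al gl g_le0.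
have eq_sum (v : I -> R) c x :
    \sum_(j <- s) (if j == i then c else v j) * alpha j x =
    \sum_(j <- s) v j * alpha j x.
  rewrite !big_seq; apply: eq_bigr => j js; case: eqVneq js => // ->.
  by rewrite (negPf iNs).
have [H|/existsNP[y /not_implyP[y_le0 /negP]]] :=
    pselect (forall x, (forall j, j \in s -> alpha j x <= 0) -> gamma x <= 0).
  have [u u0 gE] := IH alpha gamma us al gl H.
  exists (fun j => if j == i then 0 else u j) => [j|x]; first by case: ifP.
  by rewrite big_cons eqxx mul0r add0r eq_sum gE.
rewrite -ltNge => gy_gt0.
have aiy : 0 < alpha i y.
  rewrite ltNge; apply/negP => aiy; move: gy_gt0; rewrite ltNge g_le0// => j.
  by rewrite inE => /orP[/eqP->//|/y_le0].
pose z := (alpha i y)^-1 *: y.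
have linB (f : W -> R) : scalar f -> forall x,
    f (x - alpha i x *: z) = f x - alpha i x * f z.
  by move=> fl x; rewrite addrC -scaleNr fl mulNr addrC.
have linZ (f : W -> R) : scalar f -> f z = (alpha i y)^-1 * f y.
  by move=> fl; have := fl (alpha i y)^-1 y 0; rewrite !addr0 scalar0 ?addr0.
have aiz : alpha i z = 1 by rewrite linZ// mulVf// gt_eqF.
have sc_proj (f : W -> R) :
    scalar f -> scalar (fun x => f (x - alpha i x *: z)).
  by move=> fl c u v; rewrite !linB// fl al; ring.
have [|||u u0 gE] := IH (fun j x => alpha j (x - alpha i x *: z))
    (fun x => gamma (x - alpha i x *: z)) us.
- by move=> j; exact: sc_proj.
- exact: sc_proj.
- move=> x Hx; apply: g_le0 => j; rewrite inE => /orP[/eqP->|/Hx//].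
  by rewrite linB// aiz mulr1 subrr.
(* The coefficient of [alpha i] that turns the combination found for the
   projected functionals into one for the original functionals. *)
pose c := gamma z - \sum_(j <- s) u j * alpha j z.
exists (fun j => if j == i then c else u j) => [j|x].
  case: ifP => // _; rewrite /c subr_ge0 (@le_trans _ _ 0)//.
    rewrite big_seq sumr_le0// => j' js; rewrite mulr_ge0_le0//.
    by rewrite linZ// mulr_ge0_le0 ?y_le0// invr_ge0 ltW.
  rewrite linZ//; apply: mulr_ge0; last exact: ltW.
  by rewrite invr_ge0 ltW.
rewrite big_cons eqxx eq_sum.
have := gE x; rewrite linB// => /eqP; rewrite subr_eq => /eqP ->.
under eq_bigr => j _ do rewrite linB// mulrBr.
rewrite big_split/= sumrN /c mulrBl.
under [X in _ - X + _]eq_bigr => j _ do rewrite mulrCA.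
by rewrite -mulr_sumr; ring.
Qed.

(** Farkas' lemma for the linear system that says that [p] is a transport plan
    from [a] to [b] of cost at most [V], the slack of the cost bound being the
    unknown indexed by [None]. A dual certificate is a triple [(u, v, w)]; the
    multiplier [w] of the cost is kept instead of normalised to 1, so that the
    degenerate certificates [w = 0] are part of the hypothesis. *)
Lemma transport_duality (R : realFieldType) (n : nat) (c : 'I_n -> 'I_n -> R)
    (a b : 'I_n -> R) (V : R) :
  (forall (u v : 'I_n -> R) (w : R), 0 <= w ->
    (forall i j, u i + v j <= w * c i j) ->
    \sum_i u i * a i + \sum_j v j * b j <= w * V) ->
  exists p : 'I_n -> 'I_n -> R, [/\ forall i j, 0 <= p i j,
    forall i, \sum_j p i j = a i, forall j, \sum_i p i j = b j &
    \sum_i \sum_j p i j * c i j <= V].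
Proof.
move=> weak.
pose W := ('rV[R]_n * 'rV[R]_n * R^o)%type.
pose I : finType := option ('I_n * 'I_n).
pose alpha (k : I) (x : W) := match k with
  | Some (i, j) => x.1.1 0 i + x.1.2 0 j - x.2 * c i j
  | None => - x.2 end.
pose gamma (x : W) := \sum_i x.1.1 0 i * a i + \sum_j x.1.2 0 j * b j - x.2 * V.
have al k : scalar (alpha k).
  move=> t [[u v] w] [[u' v'] w']; case: k => [[i j]|] /=; rewrite ?mxE /=.
    by rewrite /GRing.scale/=; ring.
  by rewrite /GRing.scale/=; ring.
have gl : scalar gamma.
  move=> t [[u v] w] [[u' v'] w']; rewrite /gamma/=.
  under eq_bigr => i _ do rewrite !mxE mulrDl -mulrA.
  under [X in _ + X - _]eq_bigr => i _ do rewrite !mxE mulrDl -mulrA.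
  rewrite !big_split/= -!mulr_sumr /GRing.scale/=; ring.
pose s : seq I := None :: [seq Some ij | ij <- enum {: 'I_n * 'I_n}].
have us : uniq s.
  rewrite /= map_inj_uniq ?enum_uniq; last by move=> ? ? [].
  by rewrite andbT; apply/mapP => -[].
have s_all k : k \in s.
  case: k => [ij|]; last by rewrite mem_head.
  by rewrite inE/=; apply/mapP; exists ij; rewrite ?mem_enum.
have [|u u0 gE] := farkas us al gl.
  move=> [[u v] w] H; rewrite /gamma/= subr_le0.
  apply: weak => [|i j].
    by have := H None; rewrite s_all => /(_ isT)/=; rewrite oppr_le0.
  have := H (Some (i, j)); rewrite s_all => /(_ isT)/=.
  by rewrite subr_le0.
have {}gE x : gamma x = u None * - x.2 +
    \sum_i \sum_j u (Some (i, j)) * (x.1.1 0 i + x.1.2 0 j - x.2 * c i j).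
  rewrite gE big_cons/= big_map big_enum/=; congr (_ + _).
  rewrite (pair_bigA _ (fun i j => u (Some (i, j)) *
    (x.1.1 0 i + x.1.2 0 j - x.2 * c i j))).
  by apply: eq_bigr => -[].
(* The marginals and the cost of the plan are read off by evaluating the
   combination at the coordinate vectors. *)
exists (fun i j => u (Some (i, j))); split => //.
- move=> i; have := gE (delta_mx 0 i, 0, 0); rewrite /gamma/=.
  under eq_bigr => k _ do rewrite mxE eqxx/= mulrC mulr_natr mulrb.
  under [X in _ + X - _]eq_bigr => k _ do rewrite mxE mul0r.
  rewrite -big_mkcond big_pred1_eq big1// mul0r subr0 addr0 => ->.
  rewrite oppr0 mulr0 add0r.
  rewrite [RHS](bigD1 i)//= [X in _ = _ + X]big1 ?addr0.
    by apply: eq_bigr => j _; rewrite !mxE !eqxx mul0r/= addr0 subr0 mulr1.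
  move=> k ki; rewrite big1// => j _.
  by rewrite !mxE (negPf ki) andbF mul0r addr0 subr0 mulr0.
- move=> j; have := gE (0, delta_mx 0 j, 0); rewrite /gamma/=.
  under eq_bigr => k _ do rewrite mxE mul0r.
  under [X in _ + X - _]eq_bigr => k _ do
    rewrite mxE eqxx/= mulrC mulr_natr mulrb.
  rewrite -big_mkcond big_pred1_eq big1// mul0r subr0 add0r => ->.
  rewrite oppr0 mulr0 add0r; apply: eq_bigr => i _.
  rewrite [RHS](bigD1 j)//= [X in _ = _ + X]big1 ?addr0.
    by rewrite !mxE !eqxx mul0r/= add0r subr0 mulr1.
  by move=> k kj; rewrite !mxE (negPf kj) andbF mul0r addr0 subr0 mulr0.
- have := gE (0, 0, -1); rewrite /gamma/=.
  under eq_bigr => k _ do rewrite mxE mul0r.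
  under [X in _ + X - _]eq_bigr => k _ do rewrite mxE mul0r.
  rewrite [X in X + _ - _]big1// [X in _ + X - _]big1//.
  rewrite ?add0r ?sub0r !mulN1r !opprK mulr1 => ->.
  rewrite -[leLHS]add0r lerD//; apply: ler_sum => i _; apply: ler_sum => j _.
  by rewrite !mxE !add0r mulN1r opprK.
Qed.

(** * Convex functions of a real variable *)

Section subgradient.
Local Open Scope convex_scope.

Lemma convex_subgradient (R : realType) (Phi : R -> R) (w : R) :
  convex_function [set: R^o] Phi ->
  exists t : R, forall y, Phi w + t * (y - w) <= Phi y.
Proof.
move=> cvx.
have chord a b : a < w -> w < b ->
    (b - a) * Phi w <= (b - w) * Phi a + (w - a) * Phi b.
  move=> aw wb; have ba : 0 < b - a by rewrite subr_gt0 (lt_trans aw).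
  pose l := (b - w) / (b - a).
  have l0 : 0 <= l by apply: divr_ge0; rewrite subr_ge0 ltW// (lt_trans aw).
  have l1 : l <= 1 by rewrite ler_pdivrMr// mul1r lerD2l lerN2 ltW.
  have := cvx (Itv01 l0 l1) a b; rewrite !inE => /(_ Logic.I Logic.I).
  rewrite !convRE/= /unstable.onem => H.
  have lE : l * (b - a) = b - w by rewrite /l divfK// gt_eqF.
  have wE : l * a + (1 - l) * b = w by lra.
  have cE : (a : R^o) <| Itv01 l0 l1 |> b = w by rewrite convRE -[RHS]wE.
  have {}H : Phi w <= l * Phi a + (1 - l) * Phi b.
    by rewrite -(congr1 Phi cE); exact: H.
  have lE' : (1 - l) * (b - a) = w - a by lra.
  by have := ler_wpM2l (ltW ba) H; rewrite -lE -lE'; lra.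
(* The supremum of the slopes to the left of [w]; by the chord inequality it is
   bounded by every slope to the right of [w]. *)
pose S := [set (Phi w - Phi a) / (w - a) | a in [set a | a < w]].
have S0 : S !=set0.
  by exists ((Phi w - Phi (w - 1)) / (w - (w - 1))); exists (w - 1) => //=; lra.
have ubS b : w < b -> ubound S ((Phi b - Phi w) / (b - w)).
  move=> wb _ [a /= aw <-]; rewrite ler_pdivrMr ?subr_gt0//.
  rewrite mulrAC ler_pdivlMr ?subr_gt0//; have := chord a b aw wb; lra.
have hS : has_sup S.
  by split => //; exists ((Phi (w + 1) - Phi w) / (w + 1 - w)); apply: ubS; lra.
exists (sup S) => y; have [yw|wy|->] := ltgtP y w; last lra.
  have : (Phi w - Phi y) / (w - y) <= sup S.
    by apply: ub_le_sup; [exact: hS.2|exists y].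
  by rewrite ler_pdivrMr ?subr_gt0//; lra.
have : sup S <= (Phi y - Phi w) / (y - w) by apply: ge_sup => //; exact: ubS.
by rewrite ler_pdivlMr ?subr_gt0//; lra.
Qed.

End subgradient.

Section conjugate_functions.
Context {R : realType} (Phi : R -> R).
Local Open Scope ereal_scope.

Lemma fenchel_young s t : (s * t)%:E - (Phi t)%:E <= legendre Phi s.
Proof. by apply: ereal_sup_ubound; exists t. Qed.

(** Equality in the Fenchel-Young inequality at a point of tangency. It makes the
    conjugate finite at the slopes that matter and replaces the biconjugation
    theorem. *)
Lemma legendre_subgradient t w :
  (forall y, Phi w + t * (y - w) <= Phi y)%R ->
  legendre Phi t = (t * w - Phi w)%:E.
Proof.
move=> tw; apply/eqP; rewrite eq_le; apply/andP; split.
  by apply: ge_ereal_sup => _ [y _ <-]; rewrite lee_fin; have := tw y; lra.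
exact: fenchel_young.
Qed.

End conjugate_functions.

(** * Lipschitz functions and their integrals *)

Section integrals.
Context d (T : measurableType d) (R : realType).
Local Open Scope ereal_scope.

(** The integral of a nonnegative function, measurable or not, is a supremum over
    the simple functions below it. This gives access to the cost of a coupling
    without the joint measurability of the distance. *)
Lemma ge0_le_integral_nonmeasurable (mu : {measure set T -> \bar R})
    (f g : T -> \bar R) :
  (forall x, 0 <= f x) -> (forall x, f x <= g x) ->
  \int[mu]_x f x <= \int[mu]_x g x.
Proof.
move=> f0 fg; have g0 x : 0 <= g x by exact: le_trans (f0 x) (fg x).
rewrite !ge0_integralTE//; apply: ge_ereal_sup => _ [h hf <-].
by apply: ereal_sup_ubound; exists h => // x; exact: le_trans (hf x) (fg x).
Qed.

Lemma integral_finite_range (P : probability T R) (I : finType)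
    (t : T -> I) (h : I -> R) :
  (forall i, measurable (t @^-1` [set i])) ->
  P.-integrable setT (fun x => (h (t x))%:E) /\
  \int[P]_x (h (t x))%:E = (\sum_i h i * fine (P (t @^-1` [set i])))%:E.
Proof.
move=> mt.
have int_indic i :
    P.-integrable setT (fun x => (h i)%:E * (\1_(t @^-1` [set i]) x)%:E).
  by apply: integrableZl => //; exact: integrable_indic.
have hE : (fun x => (h (t x))%:E) =
    fun x => \sum_(i <- enum I) (h i)%:E * (\1_(t @^-1` [set i]) x)%:E.
  apply/funext => x; rewrite big_enum/= (bigD1 (t x))//= big1 ?adde0.
    by rewrite indicE mem_set// mule1.
  by move=> i ix; rewrite indicE memNset ?mule0//= => xi; rewrite xi eqxx in ix.
rewrite hE; split; first exact: integrable_sum.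
rewrite integral_sum// big_enum/= -sumEFin; apply: eq_bigr => i _.
rewrite integralZl//; last exact: integrable_indic.
by rewrite integral_indic// setIT EFinM fineK// fin_num_measure.
Qed.

End integrals.

Section Lipschitz_functions.
Context {R : realType} {X : completeMetricType R}.

Lemma Lipschitz1P (f : X -> R) :
  Lipschitz1 f <-> forall x y, `|f x - f y| <= mdist x y.
Proof.
split=> [[_ /= f1] x y|f1].
  have [->|xy] := eqVneq x y; first by rewrite subrr normr0 mdist_ge0.
  rewrite -[leRHS]mul1r -ler_pdivrMr ?mdist_gt0// -lee_fin.
  by apply: le_trans f1; apply: ereal_sup_ubound; exists x, y.
split; first by exists 1 => x y; rewrite mul1r.
apply: ge_ereal_sup => _ [x [y [xy ->]]].
by rewrite lee_fin ler_pdivrMr ?mdist_gt0// mul1r.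
Qed.

Lemma measurable_Lipschitz1 (f : X -> R) :
  Lipschitz1 f -> measurable_fun [set: borel X] (f : borel X -> R).
Proof.
move=> /Lipschitz1P f1.
apply: (measurability _ (RGenOpens.measurableE R)) => //.
move=> _ [_ [a [b ->]] <-]; rewrite setTI; apply: sub_sigma_algebra => /=.
apply: open_comp; last exact: interval_open.
move=> x _; apply/cvgrPdist_lt => e e0.
apply/metricType_numDomainType.nbhs_mdistP; exists e => // y /= xy.
exact: le_lt_trans (f1 x y) xy.
Qed.

End Lipschitz_functions.

Section integrability.
Context {R : realType} {X : completeMetricType R}.
Local Open Scope ereal_scope.
Implicit Types (mu : P1 X) (f : X -> R).

Lemma integrable_mdist mu (x0 : X) :
  mu.-integrable [set: borel X] (fun x : borel X => (mdist x0 (x : X))%:E).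
Proof.
apply/integrableP; split.
  by apply/measurable_EFinP; exact: measurable_mdist.
apply: le_lt_trans (P1_moment mu x0); rewrite le_eqVlt; apply/orP; left.
by apply/eqP; apply: eq_integral => x _; rewrite gee0_abs// lee_fin mdist_ge0.
Qed.

Lemma integrable_Lipschitz1 mu f : Lipschitz1 f ->
  mu.-integrable [set: borel X] (fun x : borel X => (f (x : X))%:E).
Proof.
move=> f1; pose x0 : X := point.
have : mu.-integrable [set: borel X]
    ((fun _ : borel X => `|f x0|%:E) \+
     (fun x : borel X => (mdist x0 (x : X))%:E)).
  apply: integrableD => //; last exact: integrable_mdist.
  exact: finite_measure_integrable_cst.
apply: le_integrable => //.
  by apply/measurable_EFinP; exact: measurable_Lipschitz1.
move=> x _; rewrite [leRHS]gee0_abs; last first.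
  by rewrite adde_ge0// lee_fin// mdist_ge0.
have /Lipschitz1P /(_ x0 x) := f1; rewrite distrC => fx.
rewrite abse_EFin -EFinD lee_fin -lerBlDl.
exact: le_trans (lerB_dist _ _) fx.
Qed.

Lemma integral_Lipschitz1_fin_num mu f : Lipschitz1 f ->
  \int[mu]_x (f x)%:E \is a fin_num.
Proof.
by move=> f1; apply: integrable_fin_num => //; exact: integrable_Lipschitz1.
Qed.

End integrability.

(** * Discretisation of measures with finite first moment *)

Section discretisation.
Context {R : realType} {X : completeMetricType R}.

Lemma separable_dense_sequence : separable X ->
  exists q : nat -> X, forall x (e : R), 0 < e -> exists k, mdist (q k) x < e.
Proof.
move=> [S /countable_injP[h hinj] dS].
pose q n : X := if pselect (exists2 x, S x & h x = n) is left ex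
  then s2val (cid2 ex) else point.
exists q => x e e0.
have [y [/interior_subset yx Sy]] : (ball x e)^° `&` S !=set0.
  apply: dS; last exact: open_interior.
  by exists x; exact: nbhsx_ballx.
exists (h y); have -> : q (h y) = y.
  rewrite /q; case: pselect => [ex|[]]; last by exists y.
  by case: cid2 => z Sz hz /=; apply: hinj; rewrite ?inE.
by move: yx; rewrite ballEmdist/= metric_sym.
Qed.

Variable q : nat -> X.

(** The index of a point closest to [x] among [q 0, ..., q n], computed by
    recursion so that its measurability is an induction on [n]. *)
Fixpoint nearest (n : nat) (x : X) : nat :=
  if n is m.+1 then
    if mdist (q n) x < mdist (q (nearest m x)) x then n else nearest m x
  else 0.

Lemma nearest_le n x : (nearest n x <= n)%N.
Proof. by elim: n => //= n IH; case: ifP => // _; exact: leqW. Qed.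

Lemma mdist_nearest_le n k x : (k <= n)%N ->
  mdist (q (nearest n x)) x <= mdist (q k) x.
Proof.
elim: n => [|n IH]; first by rewrite leqn0 => /eqP->.
rewrite leq_eqVlt => /orP[/eqP->|]/=; last rewrite ltnS => /IH kn.
  by case: ltP.
by case: ltP => // /ltW/le_trans; exact.
Qed.

Lemma measurable_nearest n :
  measurable_fun [set: borel X] (nearest n : borel X -> nat) /\
  measurable_fun [set: borel X]
    ((fun x => mdist (q (nearest n x)) x) : borel X -> R).
Proof.
elim: n => [|n [IHn IHd]].
  by split; [exact: measurable_cst|exact: (measurable_mdist (q 0))].
have mlt : measurable_fun [set: borel X]
    (fun x : borel X => mdist (q n.+1) (x : X) < mdist (q (nearest n x)) x).
  by apply: measurable_fun_ltr => //; exact: (measurable_mdist (q n.+1)).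
split => /=.
  by apply: measurable_fun_ifT => //; exact: measurable_cst.
rewrite [X in measurable_fun _ X](_ : _ = fun x : borel X =>
  if mdist (q n.+1) (x : X) < mdist (q (nearest n x)) x
  then mdist (q n.+1) (x : X) else mdist (q (nearest n x)) x); last first.
  by apply/funext => x; case: ifP.
by apply: measurable_fun_ifT => //; exact: (measurable_mdist (q n.+1)).
Qed.

Local Open Scope ereal_scope.

(** Dominated convergence: density of [q] makes the distance from [x] to the
    nearest point tend to 0, and it never exceeds the integrable function
    [mdist (q 0)]. *)
Lemma cvg_integral_nearest (mu : P1 X) :
  (forall x (e : R), (0 < e)%R -> exists k, (mdist (q k) x < e)%R) ->
  \int[mu]_x (mdist (q (nearest n x)) x)%:E @[n --> \oo] --> 0.
Proof.
move=> dq; rewrite -(integral0 mu [set: borel X]).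
apply: (@dominated_cvg _ _ _ mu _ measurableT _ _
  (fun x : borel X => (mdist (q 0) (x : X))%:E)) => //.
- by move=> n; apply/measurable_EFinP; exact: (measurable_nearest n).2.
- move=> x _; apply: cvg_EFin; first exact: nearW.
  apply/cvgrPdist_lt => e e0; have [k kx] := dq x e e0.
  near=> n; rewrite /= sub0r normrN ger0_norm ?mdist_ge0//.
  apply: le_lt_trans kx; apply: mdist_nearest_le; near: n; exact: nbhs_infty_ge.
- exact: integrable_mdist.
- move=> n x _; rewrite gee0_abs ?lee_fin ?mdist_ge0//.
  exact: mdist_nearest_le.
Unshelve. all: by end_near. Qed.

End discretisation.

(** * Couplings with prescribed masses on the cells of a finite partition *)

Section coupling.
Context d (T : measurableType d) (R : realType) (mu nu : probability T R).
Variables (n : nat) (s : T -> nat) (p : nat -> nat -> R).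
Hypotheses (ms : measurable_fun [set: T] s) (s_lt : forall x, (s x < n)%N).
Hypothesis p_ge0 : forall i j, 0 <= p i j.
Hypothesis p_row : forall i, (i < n)%N ->
  ((\sum_(j < n) p i j)%:E = mu (s @^-1` [set i]))%E.
Hypothesis p_col : forall j, (j < n)%N ->
  ((\sum_(i < n) p i j)%:E = nu (s @^-1` [set j]))%E.

Let cell i := s @^-1` [set i].

Let mcell i : measurable (cell i).
Proof. by rewrite -[cell i]setTI; exact: ms. Qed.

Let mcell2 i j : measurable (cell i `*` cell j).
Proof. exact: measurableX. Qed.

Let a i := fine (mu (cell i)).
Let b j := fine (nu (cell j)).

Let aE i : mu (cell i) = (a i)%:E.
Proof. by rewrite /a fineK// fin_num_measure. Qed.

Let bE i : nu (cell i) = (b i)%:E.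
Proof. by rewrite /b fineK// fin_num_measure. Qed.

Let a_ge0 i : 0 <= a i. Proof. exact: fine_ge0. Qed.
Let b_ge0 i : 0 <= b i. Proof. exact: fine_ge0. Qed.

Let row i : (i < n)%N -> \sum_(j < n) p i j = a i.
Proof. by move=> /p_row; rewrite [X in _ = X]aE => -[]. Qed.

Let col j : (j < n)%N -> \sum_(i < n) p i j = b j.
Proof. by move=> /p_col; rewrite [X in _ = X]bE => -[]. Qed.

Let weight_ge0 i j : 0 <= p i j / (a i * b j).
Proof. by rewrite divr_ge0// mulr_ge0. Qed.

(* If [a i] or [b j] vanishes, then so does [p i j], a term of the sum that is
   [a i] or [b j]. *)
Let weightK i j : (i < n)%N -> (j < n)%N ->
  p i j / (a i * b j) * (a i * b j) = p i j.
Proof.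
move=> ni nj; have [ab0|ab0] := eqVneq (a i * b j) 0; last by rewrite divfK.
rewrite ab0 mulr0; apply/esym/eqP; rewrite eq_le p_ge0 andbT.
move/eqP : ab0; rewrite mulf_eq0 => /orP[]/eqP <-.
  by rewrite -row// (bigD1 (Ordinal nj))//= lerDl sumr_ge0.
by rewrite -col// (bigD1 (Ordinal ni))//= lerDl sumr_ge0.
Qed.

Let piece i j : {measure set (T * T) -> \bar R} :=
  mscale (NngNum (weight_ge0 i j)) (mrestr (mu \x nu)%E (mcell2 i j)).

Let strip i : {measure set (T * T) -> \bar R} := msum (piece i) n.

(** On each rectangle [cell i `*` cell j] this is the multiple of the product
    measure that has total mass [p i j]. *)
Definition cell_coupling : set (T * T) -> \bar R := msum strip n.

HB.instance Definition _ := Measure.on cell_coupling.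

Local Open Scope ereal_scope.

Let cell_couplingE (B C : set T) : measurable B -> measurable C ->
  cell_coupling (B `*` C) = \sum_(i < n) \sum_(j < n)
    (p i j / (a i * b j))%:E * (mu (B `&` cell i) * nu (C `&` cell j)).
Proof.
move=> mB mC; rewrite /cell_coupling /=/msum; apply: eq_bigr => i _.
rewrite /strip/= /msum; apply: eq_bigr => j _.
rewrite /piece/= /mscale/= /mrestr -setXI product_measure1E//.
  exact: measurableI.
exact: measurableI.
Qed.

Let cells (m : probability T R) (B : set T) : measurable B ->
  \sum_(i < n) m (B `&` cell i) = m B.
Proof.
move=> mB.
rewrite -(@measure_semi_additive_ord_I _ _ _ m (fun i => B `&` cell i)).
- congr (m _); rewrite -(bigcup_mkord n (fun i => B `&` cell i)) -setI_bigcupr.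
  by apply/setIidl => x Bx; exists (s x) => /=.
- by move=> i _; exact: measurableI.
- apply/trivIsetP => i j _ _ ij; rewrite setIACA setIid.
  rewrite (_ : cell i `&` cell j = set0) ?setI0//.
  by apply/seteqP; split => // x [/= e1 e2]; move: ij; rewrite -e1 -e2 eqxx.
- by apply: bigsetU_measurable => i _; exact: measurableI.
Qed.

Let cell_le (m : probability T R) (B : set T) i : measurable B ->
  exists2 r : R, m (B `&` cell i) = r%:E & (0 <= r <= fine (m (cell i)))%R.
Proof.
move=> mB; exists (fine (m (B `&` cell i))).
  by rewrite fineK// fin_num_measure//; exact: measurableI.
rewrite fine_ge0//= fine_le ?fin_num_measure//; first exact: measurableI.
by apply: le_measure; rewrite ?inE//; exact: measurableI.
Qed.

Lemma cell_coupling_fst (B : set T) : measurable B ->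
  cell_coupling (B `*` setT) = mu B.
Proof.
move=> mB; rewrite cell_couplingE// -[RHS]cells//; apply: eq_bigr => i _.
under eq_bigr => j _ do rewrite setTI bE.
have [r -> /andP[r0 ra]] := cell_le mu i mB; rewrite -/(a i) in ra.
under eq_bigr => j _ do rewrite -!EFinM.
rewrite sumEFin; congr _%:E.
have [ai0|ai0] := eqVneq (a i) 0%R.
  have -> : r = 0%R by apply/eqP; rewrite eq_le r0 andbT -ai0.
  by rewrite big1// => j _; rewrite mul0r mulr0.
apply: (mulIf ai0); rewrite mulr_suml -[in RHS](row (ltn_ord i)) mulr_sumr.
apply: eq_bigr => j _.
by rewrite -[in RHS](weightK (ltn_ord i) (ltn_ord j)); ring.
Qed.

Lemma cell_coupling_snd (B : set T) : measurable B ->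
  cell_coupling (setT `*` B) = nu B.
Proof.
move=> mB; rewrite cell_couplingE// -[RHS]cells// exchange_big/=.
apply: eq_bigr => j _.
under eq_bigr => i _ do rewrite setTI aE.
have [r -> /andP[r0 rb]] := cell_le nu j mB; rewrite -/(b j) in rb.
under eq_bigr => i _ do rewrite -!EFinM.
rewrite sumEFin; congr _%:E.
have [bj0|bj0] := eqVneq (b j) 0%R.
  have -> : r = 0%R by apply/eqP; rewrite eq_le r0 andbT -bj0.
  by rewrite big1// => i _; rewrite !mulr0.
apply: (mulIf bj0); rewrite mulr_suml -[in RHS](col (ltn_ord j)) mulr_sumr.
apply: eq_bigr => i _.
by rewrite -[in RHS](weightK (ltn_ord i) (ltn_ord j)); ring.
Qed.

Lemma cell_coupling_cell i j : (i < n)%N -> (j < n)%N ->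
  cell_coupling (cell i `*` cell j) = (p i j)%:E.
Proof.
move=> ni nj; rewrite cell_couplingE//.
have cellI k l : k != l -> cell k `&` cell l = set0.
  move=> kl; apply/seteqP; split => // x [/= e1 e2].
  by move: kl; rewrite -e1 -e2 eqxx.
rewrite (bigD1 (Ordinal ni))//= [X in _ + X]big1 ?adde0; last first.
  move=> k ki; rewrite big1// => l _; rewrite [X in mu X]cellI; last first.
    by rewrite eq_sym; exact: ki.
  by rewrite measure0 mul0e mule0.
rewrite (bigD1 (Ordinal nj))//= [X in _ + X]big1 ?adde0; last first.
  move=> l lj; rewrite [X in nu X]cellI; last by rewrite eq_sym; exact: lj.
  by rewrite measure0 !mule0.
by rewrite !setIid aE bE -!EFinM weightK.
Qed.

(** A transport plan between the masses of the cells of two probability measures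
    is realised by a coupling of the measures themselves. *)
Lemma cell_coupling_probability : exists P : probability (T * T)%type R,
  [/\ forall B, measurable B -> P (B `*` setT) = mu B,
      forall B, measurable B -> P (setT `*` B) = nu B &
      forall i j, (i < n)%N -> (j < n)%N -> P (cell i `*` cell j) = (p i j)%:E].
Proof.
have cT : cell_coupling setT = 1.
  by rewrite -setXTT cell_coupling_fst// probability_setT.
pose P : probability (T * T)%type R := HB.pack cell_coupling
  (Measure_isProbability.Build _ _ _ cell_coupling cT).
exists P; split; [exact: cell_coupling_fst|exact: cell_coupling_snd|].
exact: cell_coupling_cell.
Qed.

End coupling.

(** * Kantorovich-Rubinstein duality *)

Section weak_duality.
Context {R : realType} {X : completeMetricType R}.
Local Open Scope ereal_scope.
Implicit Types (mu nu : P1 X) (f : X -> R).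

Lemma has_law_ge0_integral d (Omega : measurableType d)
    (P : probability Omega R) (Y : {RV P >-> borel X}) mu
    (h : borel X -> \bar R) :
  has_law Y mu -> measurable_fun setT h -> (forall x, 0 <= h x) ->
  \int[P]_w h (Y w) = \int[mu]_x h x.
Proof.
move=> Ymu mh h0; rewrite -(ge0_integral_distribution Y mh h0).
by apply: eq_measure_integral => A mA _; exact: Ymu.
Qed.

Lemma has_law_integral d (Omega : measurableType d) (P : probability Omega R)
    (Y : {RV P >-> borel X}) mu f : has_law Y mu -> Lipschitz1 f ->
  P.-integrable setT (fun w => (f (Y w))%:E) /\
  \int[P]_w (f (Y w))%:E = \int[mu]_x (f x)%:E.
Proof.
move=> Ymu f1.
have mf : measurable_fun [set: borel X] (fun x : borel X => (f (x : X))%:E).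
  by apply/measurable_EFinP; exact: measurable_Lipschitz1.
have fY : P.-integrable setT (fun w => (f (Y w))%:E).
  apply/integrableP; split.
    by apply: (measurableT_comp mf); exact: measurable_funP.
  have /integrableP[_] := integrable_Lipschitz1 mu f1.
  by rewrite -(has_law_ge0_integral Ymu)//; exact: measurableT_comp.
split => //; rewrite -(integral_distribution mf fY).
by apply: eq_measure_integral => A mA _; exact: Ymu.
Qed.

Lemma Lipschitz1_gap_le_W1 mu nu f : Lipschitz1 f ->
  \int[nu]_x (f x)%:E - \int[mu]_x (f x)%:E <= W1 mu nu.
Proof.
move=> f1; apply: le_ereal_inf_tmp => _ [d [ Om [ P [Y [Z [Ymu Znu ->]]]]]].
have [iY <-] := has_law_integral Ymu f1.
have [iZ <-] := has_law_integral Znu f1.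
rewrite -integralB// unlock; apply: le_trans (lee_abs _) _.
apply: le_trans (le_abse_integral _ _ _) _ => //.
  apply: emeasurable_funB; first exact: measurable_int iZ.
  exact: measurable_int iY.
apply: ge0_le_integral_nonmeasurable => // w.
rewrite /= lee_fin metric_sym.
by move/Lipschitz1P : f1; exact.
Qed.

End weak_duality.

Section strong_duality.
Context {R : realType} {X : completeMetricType R}.
Local Open Scope ereal_scope.
Implicit Types (mu nu : P1 X) (f : X -> R).

(** Rescaling from Lipschitz constant 1 to [w]. The case [w = 0] is the one of
    constant functions, on which two probability measures agree. *)
Lemma Lipschitz_gap mu nu (D w : R) f : (0 <= w)%R ->
  (forall f, Lipschitz1 f ->
    \int[nu]_x (f x)%:E - \int[mu]_x (f x)%:E <= D%:E) ->
  (forall x y, `|f x - f y| <= w * mdist x y)%R ->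
  [/\ mu.-integrable [set: borel X] (fun x : borel X => (f (x : X))%:E),
      nu.-integrable [set: borel X] (fun x : borel X => (f (x : X))%:E) &
      \int[nu]_x (f x)%:E - \int[mu]_x (f x)%:E <= (w * D)%:E].
Proof.
move=> w0 gapD fw; have [w00|wn0] := eqVneq w 0%R.
  have -> : f = fun=> f point.
    apply/funext => x; apply/eqP; rewrite -subr_eq0 -normr_le0.
    by rewrite (le_trans (fw _ _))// w00 mul0r.
  split; try exact: finite_measure_integrable_cst.
  by rewrite !integral_cst//= !probability_setT !mule1 -EFinB subrr w00 mul0r.
have {w0}wgt0 : (0 < w)%R by rewrite lt_neqAle eq_sym wn0.
pose g x := (w^-1 * f x)%R.
have g1 : Lipschitz1 g.
  apply/Lipschitz1P => x y; rewrite /g -mulrBr normrM gtr0_norm ?invr_gt0//.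
  by rewrite ler_pdivrMl.
have fE : (fun x : borel X => (f (x : X))%:E) = fun x => w%:E * (g x)%:E.
  by apply/funext => x; rewrite -EFinM /g mulVKf.
have ig (m : P1 X) :
    m.-integrable [set: borel X] (fun x : borel X => (g (x : X))%:E).
  exact: integrable_Lipschitz1.
have [igmu ignu] := (ig mu, ig nu).
rewrite fE; split; [exact: integrableZl|exact: integrableZl|].
rewrite !integralZl// -muleBr// ?EFinM.
  by rewrite lee_pmul2l// gapD.
by rewrite fin_num_adde_defl// fin_numN integral_Lipschitz1_fin_num.
Qed.

(** The largest function that is [w]-Lipschitz and at most [- u i] at [q i]: the
    lower envelope of finitely many cones. It turns a potential on the points [q]
    into a Lipschitz function on the whole space. *)
Lemma inf_convolution_potential (n : nat) (q : nat -> X) (u : 'I_n.+1 -> R)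
    (w : R) : (0 <= w)%R ->
  exists f : X -> R,
  [/\ forall x y, (`|f x - f y| <= w * mdist x y)%R,
      forall x (i : 'I_n.+1), (f x <= w * mdist (q i) x - u i)%R &
      forall x, exists i : 'I_n.+1, f x = (w * mdist (q i) x - u i)%R].
Proof.
move=> w0; pose F x i := (w * mdist (q (val i)) x - u i)%R.
have /choice[k kmin] x : exists k, forall i, (F x k <= F x i)%R.
  by exists [arg min_(i < ord0) F x i]%O => i; case: arg_minP => // k _; exact.
exists (fun x => F x (k x)); split => // [x y|x]; last by exists (k x).
have FL x' y' : (F x' (k x') - F y' (k y') <= w * mdist x' y')%R.
  apply: (@le_trans _ _ (F x' (k y') - F y' (k y'))%R); first by rewrite lerB.
  rewrite /F opprB addrA subrK -mulrBr ler_wpM2l// lerBlDr.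
  by rewrite addrC (metric_sym x') metric_triangle.
by rewrite ler_norml FL andbT lerNl opprB metric_sym FL.
Qed.

(** The hard half of the Kantorovich-Rubinstein duality. Both measures are moved
    to the same finite set of points [q i], at a total cost [Emu + Enu] that is
    as small as desired. If every 1-Lipschitz function gains at most [D], then the
    discretised masses admit a transport plan of cost at most [D + Emu + Enu]
    (transport duality), and the coupling that realises this plan costs at most
    [D + 2 * (Emu + Enu)]. *)
Theorem W1_le_Lipschitz1_gap mu nu (D : R) : separable X ->
  (forall f, Lipschitz1 f ->
    \int[nu]_x (f x)%:E - \int[mu]_x (f x)%:E <= D%:E) ->
  W1 mu nu <= D%:E.
Proof.
move=> sepX gapD; apply/lee_addgt0Pr => e e0.
have [q dq] := separable_dense_sequence sepX.
pose g n (x : borel X) := mdist (q (nearest q n x)) (x : X).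
have mg n : measurable_fun setT (fun x => (g n x)%:E).
  by apply/measurable_EFinP; exact: (measurable_nearest q n).2.
have g0 n x : 0 <= (g n x)%:E by rewrite lee_fin mdist_ge0.
have small (m : P1 X) : \forall n \near \oo, \int[m]_x (g n x)%:E < (e / 4)%:E.
  have := cvg_integral_nearest m dq.
  move=> /fine_cvgP[fin /cvgrPdist_lt /(_ (e / 4)%R)].
  rewrite divr_gt0// => /(_ isT) lim; near=> n.
  have fn : \int[m]_x (g n x)%:E \is a fin_num by near: n.
  rewrite -(fineK fn) lte_fin.
  have : (`|0 - fine (\int[m]_x (g n x)%:E)| < e / 4)%R by near: n.
  by rewrite sub0r normrN ger0_norm// fine_ge0// integral_ge0.
have [n [Emu_lt Enu_lt]] : exists n,
    \int[mu]_x (g n x)%:E < (e / 4)%:E /\ \int[nu]_x (g n x)%:E < (e / 4)%:E.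
  have [n [? ?]] := filter_ex (filterI (small mu) (small nu)).
  by exists n.
pose s (x : borel X) : 'I_n.+1 := inord (nearest q n x).
have sE x : val (s x) = nearest q n x by rewrite /= inordK// ltnS nearest_le.
have cellE i : s @^-1` [set i] = nearest q n @^-1` [set val i] :> set (borel X).
  apply/seteqP; split => x /=; first by move=> <-; rewrite sE.
  by rewrite -sE => /val_inj.
have mcell i : measurable (s @^-1` [set i]).
  by rewrite cellE -[X in measurable X]setTI; exact: (measurable_nearest q n).1.
have gfin (m : P1 X) : \int[m]_x (g n x)%:E < (e / 4)%:E ->
    m.-integrable setT (fun x => (g n x)%:E) /\
    \int[m]_x (g n x)%:E = (fine (\int[m]_x (g n x)%:E))%:E.
  move=> h; split.
    apply/integrableP; split => //.
    under eq_integral => x _ do rewrite gee0_abs//.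
    exact: lt_trans h (ltry _).
  by rewrite fineK// ge0_fin_numE ?integral_ge0//; exact: lt_trans h (ltry _).
have [igmu gmuE] := gfin mu Emu_lt; have [ignu gnuE] := gfin nu Enu_lt.
set Emu := fine (\int[mu]_x _) in gmuE; set Enu := fine (\int[nu]_x _) in gnuE.
pose a i := fine (mu (s @^-1` [set i])).
pose b i := fine (nu (s @^-1` [set i])).
pose c (i j : 'I_n.+1) := mdist (q i) (q j).
have [p [p0 pa pb pc]] : exists p : 'I_n.+1 -> 'I_n.+1 -> R,
    [/\ forall i j, (0 <= p i j)%R, forall i, (\sum_j p i j = a i)%R,
        forall j, (\sum_i p i j = b j)%R &
        (\sum_i \sum_j p i j * c i j <= D + Emu + Enu)%R].
  apply: transport_duality => u v w w0 uv.
  have [f [fLip f_le f_eq]] := inf_convolution_potential q u w0.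
  have [ifmu ifnu] := Lipschitz_gap w0 gapD fLip.
  have [isu su] := integral_finite_range mu u mcell.
  have [isv sv] := integral_finite_range nu v mcell.
  rewrite -(fineK (integrable_fin_num measurableT ifmu)).
  rewrite -(fineK (integrable_fin_num measurableT ifnu)).
  set Fnu := fine _; set Fmu := fine _; rewrite -EFinB lee_fin => gapF.
  (* The cone with apex [q (s x)] bounds [f] from above at [x]. *)
  have Umu : (\sum_i u i * a i <= w * Emu - Fmu)%R.
    rewrite -lee_fin -su EFinB EFinM -gmuE /Fmu fineK ?integrable_fin_num//.
    rewrite -integralZl// -integralB//; last exact: integrableZl.
    apply: le_integral => //.
      by apply: integrableB => //; exact: integrableZl.
    move=> x _; rewrite -EFinM -EFinB lee_fin.
    by have := f_le x (s x); rewrite sE /g; lra.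
  (* [f] lies above [v] at the points [q j] by the constraint on [u] and [v], up
     to the error of replacing [x] by [q (s x)]. *)
  have Vnu : (\sum_j v j * b j <= w * Enu + Fnu)%R.
    rewrite -lee_fin -sv EFinD EFinM -gnuE /Fnu fineK ?integrable_fin_num//.
    rewrite -integralZl// -integralD//; last exact: integrableZl.
    apply: le_integral => //.
      by apply: integrableD => //; exact: integrableZl.
    move=> x _; rewrite -EFinM -EFinD lee_fin.
    have [k ->] := f_eq x; have := uv k (s x).
    have : (w * c k (s x) <= w * (g n x + mdist (q k) x))%R.
      rewrite ler_wpM2l// /c sE /g.
      apply: le_trans (metric_triangle _ (x : X) _) _.
      by rewrite addrC lerD2r metric_sym.
    by lra.
  by lra.
have cellN i : (i < n.+1)%N ->
    nearest q n @^-1` [set i] = s @^-1` [set inord i] :> set (borel X).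
  by move=> ni; rewrite cellE /= inordK.
have row i : (i < n.+1)%N ->
    (\sum_(j < n.+1) p (inord i) (inord j))%:E = mu (nearest q n @^-1` [set i]).
  move=> ni; under eq_bigr do rewrite inord_val.
  by rewrite pa /a cellN// fineK// fin_num_measure.
have col j : (j < n.+1)%N ->
    (\sum_(i < n.+1) p (inord i) (inord j))%:E = nu (nearest q n @^-1` [set j]).
  move=> nj; under eq_bigr do rewrite inord_val.
  by rewrite pb /b cellN// fineK// fin_num_measure.
have s_lt (x : borel X) : (nearest q n x < n.+1)%N by rewrite ltnS nearest_le.
have [P [Pfst Psnd Pcell]] := cell_coupling_probability
  (measurable_nearest q n).1 s_lt (fun i j => p0 (inord i) (inord j)) row col.
pose Y : {RV P >-> borel X} := HB.pack (@fst (borel X) (borel X))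
  (isMeasurableFun.Build _ _ _ _ (@fst (borel X) (borel X)) measurable_fst).
pose Z : {RV P >-> borel X} := HB.pack (@snd (borel X) (borel X))
  (isMeasurableFun.Build _ _ _ _ (@snd (borel X) (borel X)) measurable_snd).
have Ymu : has_law Y mu.
  move=> A mA; rewrite -Pfst//; congr (P _).
  by apply/seteqP; split => -[x y]//= [].
have Znu : has_law Z nu.
  move=> A mA; rewrite -Psnd//; congr (P _).
  by apply/seteqP; split => -[x y]//= [].
apply: (@le_trans _ _ 'E_P[fun w => mdist (Y w : X) (Z w : X)]).
  by apply: ereal_inf_lbound; exists _, _, P, Y, Z.
pose ss (z : borel X * borel X) := (s z.1, s z.2).
have ssE ij : ss @^-1` [set ij] = (s @^-1` [set ij.1]) `*` (s @^-1` [set ij.2]).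
  case: ij => i j; apply/seteqP; split => -[x y] /=; first by move=> [-> ->].
  by move=> [xi yj]; rewrite /ss/= xi yj.
have [iss ssI] := integral_finite_range P (fun ij => c ij.1 ij.2)
  (t := ss) ltac:(by move=> ij; rewrite ssE; exact: measurableX).
have mss := measurable_int _ iss.
rewrite unlock.
(* Travel from [z.1] to [z.2] through their nearest points. The bound is
   measurable on the product. *)
apply: (@le_trans _ _ (\int[P]_z ((g n (Y z))%:E + (g n (Z z))%:E +
    (c (s z.1) (s z.2))%:E))).
  apply: ge0_le_integral_nonmeasurable => z; rewrite ?lee_fin ?mdist_ge0//=.
  rewrite /g /c !sE.
  apply: le_trans (metric_triangle _ (q (nearest q n z.1)) _) _.
  rewrite -addrA metric_sym lerD2l addrC.
  exact: metric_triangle.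
have mgY : measurable_fun setT (fun z => (g n (Y z))%:E).
  by apply: (measurableT_comp (mg n)); exact: measurable_funP.
have mgZ : measurable_fun setT (fun z => (g n (Z z))%:E).
  by apply: (measurableT_comp (mg n)); exact: measurable_funP.
rewrite ge0_integralD//; last 3 first.
- by move=> z _; rewrite adde_ge0.
- exact: emeasurable_funD.
- by move=> z _; rewrite lee_fin mdist_ge0.
rewrite ge0_integralD// (has_law_ge0_integral Ymu (mg n))//.
rewrite (has_law_ge0_integral Znu (mg n))// ssI.
have pcE : (\sum_ij c ij.1 ij.2 * fine (P (ss @^-1` [set ij])) =
    \sum_i \sum_j p i j * c i j)%R.
  rewrite pair_bigA; apply: eq_bigr => -[i j] _ /=.
  by rewrite ssE/= !cellE Pcell//= !inord_val mulrC.
rewrite pcE; rewrite gmuE gnuE in Emu_lt Enu_lt *.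
rewrite -!EFinD lee_fin; rewrite !lte_fin in Emu_lt Enu_lt.
by lra.
Unshelve. all: by end_near. Qed.

Lemma integral_Lipschitz1_le mu f (x0 : X) : Lipschitz1 f ->
  \int[mu]_x (f x)%:E <= (f x0)%:E + \int[mu]_x (mdist x0 x)%:E.
Proof.
move=> f1; have cst_int : \int[mu]_x (f x0)%:E = (f x0)%:E.
  by rewrite integral_cst//= probability_setT mule1.
rewrite -[in leRHS]cst_int -integralD//; last 2 first.
- exact: finite_measure_integrable_cst.
- exact: integrable_mdist.
apply: le_integral => //; first exact: integrable_Lipschitz1.
  apply: integrableD => //; last exact: integrable_mdist.
  exact: finite_measure_integrable_cst.
move=> x _; rewrite -EFinD lee_fin addrC -lerBlDr metric_sym.
by have /Lipschitz1P /(_ x x0) := f1; apply: le_trans; exact: ler_norm.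
Qed.

(** The gain of a 1-Lipschitz function is at most the sum of the two first
    moments, so the duality bounds the distance. *)
Lemma W1_fin_num mu nu : separable X -> W1 mu nu \is a fin_num.
Proof.
move=> sepX; pose x0 : X := point.
have M_fin (m : P1 X) : \int[m]_x (mdist x0 x)%:E \is a fin_num.
  by apply: integrable_fin_num => //; exact: integrable_mdist.
have W1_ge0 : 0 <= W1 mu nu.
  apply: le_ereal_inf_tmp => _ [d [ Om [ P [Y [Z [_ _ ->]]]]]].
  by apply: expectation_ge0 => w; exact: mdist_ge0.
rewrite ge0_fin_numE//.
apply: (@le_lt_trans _ _ (fine (\int[mu]_x (mdist x0 x)%:E) +
    fine (\int[nu]_x (mdist x0 x)%:E))%:E); last exact: ltry.
apply: W1_le_Lipschitz1_gap => // f f1.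
have Nf1 : Lipschitz1 (fun x => - f x)%R.
  apply/Lipschitz1P => x y; rewrite -opprD normrN.
  by have /Lipschitz1P := f1; exact.
have := integral_Lipschitz1_le nu x0 f1.
have := integral_Lipschitz1_le mu x0 Nf1.
have -> : \int[mu]_x (- f x)%:E = - \int[mu]_x (f x)%:E.
  have if1 := integrable_Lipschitz1 mu f1.
  rewrite -mulN1e -integralZl//; apply: eq_integral => x _.
  by rewrite -EFinM mulN1r.
rewrite EFinD -(fineK (M_fin mu)) -(fineK (M_fin nu)).
rewrite -(fineK (integral_Lipschitz1_fin_num mu f1)).
rewrite -(fineK (integral_Lipschitz1_fin_num nu f1)).
by rewrite -!EFinN -!EFinD !lee_fin; lra.
Qed.

End strong_duality.

(** * Transport inequalities and risk measures *)

Section penalty.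
Context {R : realType} {X : completeMetricType R}.
Local Open Scope ereal_scope.

(** [L] may be [+oo]: then the argument of [rho] is constantly [-oo], and both
    sides hold. *)
Lemma rho_le0P (phi : P1 X -> \bar R) (f : X -> R) (t : R) (nu : P1 X)
    (L : \bar R) :
  (forall mu, -oo < phi mu) -> -oo < L -> Lipschitz1 f ->
  rho phi (fun x : X =>
    t%:E * (\int[nu]_y (f y)%:E) - t%:E * (f x)%:E - L) <= 0
  <-> forall mu : P1 X,
    t%:E * (\int[nu]_x (f x)%:E - \int[mu]_x (f x)%:E) - L <= phi mu.
Proof.
move=> phiNy LNy f1.
have intE (mu : P1 X) :
    \int[mu]_x (t%:E * (\int[nu]_y (f y)%:E) - t%:E * (f x)%:E - L) =
    t%:E * (\int[nu]_x (f x)%:E - \int[mu]_x (f x)%:E) - L.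
  have ifmu := integrable_Lipschitz1 mu f1.
  have real (m : P1 X) : exists r : R, \int[m]_x (f x)%:E = r%:E.
    by eexists; rewrite -[LHS]fineK// integral_Lipschitz1_fin_num.
  have [[M muE] [N nuE]] := (real mu, real nu).
  rewrite muE nuE.
  case: L LNy => [l _| _|//]; last first.
    transitivity (\int[mu]_x (cst -oo (x : borel X))).
      by apply: eq_integral => x _; rewrite addeNy.
    by rewrite integral_cst//= probability_setT mule1 addeNy.
  have ic (r : R) : mu.-integrable [set: borel X] (fun=> r%:E).
    exact: finite_measure_integrable_cst.
  rewrite (_ : (fun x : borel X => _) =
    (fun x : borel X => (t * N - l)%:E - t%:E * (f x)%:E)); last first.
    by apply/funext => x; rewrite -!EFinM -!EFinB; congr _%:E; ring.
  rewrite integralB//; last exact: integrableZl.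
  rewrite integralZl// integral_cst//= probability_setT mule1 muE.
  by rewrite -!EFinM -!EFinB; congr _%:E; ring.
have LE (mu : P1 X) :
    t%:E * (\int[nu]_x (f x)%:E - \int[mu]_x (f x)%:E) - L < +oo.
  rewrite -(fineK (integral_Lipschitz1_fin_num mu f1)).
  rewrite -(fineK (integral_Lipschitz1_fin_num nu f1)).
  by case: L LNy {intE} => //= l _; rewrite -!EFinM -!EFinB ltry.
split=> [rho_le0 mu|le_phi].
  have : \int[mu]_x (t%:E * (\int[nu]_y (f y)%:E) - t%:E * (f x)%:E - L)
      - phi mu <= 0.
    by apply: le_trans rho_le0; apply: ereal_sup_ubound; exists mu.
  rewrite intE; case: (phi mu) (phiNy mu) => [r _|_ _|//]; last exact: leey.
  by rewrite leeBlDr// add0e.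
apply: ge_ereal_sup => _ [mu _ <-]; rewrite intE.
case: (phi mu) (le_phi mu) (phiNy mu) => [r le_r _|_ _|//].
  by rewrite leeBlDr// add0e.
by have := LE mu; case: (_ - L) => //= *; rewrite leNye.
Qed.

End penalty.

Theorem corollary1p2 (R : realType) (X : completeMetricType R)
    (X_separable : separable X)
    (phi : P1 X -> \bar R) (phi_proper_convex : proper_convex phi)
    (Phi : R -> R) (Phi_increasing : {homo Phi : s t / s <= t})
    (Phi_convex : convex_function [set: R^o] Phi) (Phi0 : Phi 0 = 0)
    (nu : P1 X) :
  (forall mu : P1 X, ((Phi (fine (W1 mu nu)))%:E <= phi mu)%E)
  <->
  (forall (f : X -> R) (t : R), Lipschitz1 f ->
    (rho phi (fun x : X => t%:E * (\int[nu]_y (f y)%:E) - t%:E * (f x)%:E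
                           - legendre Phi t) <= 0)%E).
Proof.
have [_ _ phiNy _] := phi_proper_convex.
have LNy t : (-oo < legendre Phi t)%E.
  by apply: lt_le_trans (fenchel_young Phi t 0); rewrite -EFinB ltNyr.
have gapE (f : X -> R) (mu : P1 X) : Lipschitz1 f -> exists2 z : R,
    (\int[nu]_x (f x)%:E - \int[mu]_x (f x)%:E)%E = z%:E & z <= fine (W1 mu nu).
  move=> f1; exists (fine (\int[nu]_x (f x)%:E - \int[mu]_x (f x)%:E)%E).
    by rewrite fineK// fin_numB !integral_Lipschitz1_fin_num.
  apply: fine_le; [|exact: W1_fin_num|exact: Lipschitz1_gap_le_W1].
  by rewrite fin_numB !integral_Lipschitz1_fin_num.
split=> [le_phi f t f1|rho_le0 mu].
  apply/(rho_le0P t nu phiNy (LNy t) f1) => mu; apply: le_trans (le_phi mu).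
  have [z -> zW] := gapE f mu f1.
  apply: (@le_trans _ _ (Phi z)%:E); last by rewrite lee_fin Phi_increasing.
  have := fenchel_young Phi t z; case: (legendre Phi t) (LNy t) => [l _|_ _|//].
    by rewrite -!EFinM -!EFinB !lee_fin lerBlDr addrC -lerBlDr.
  by rewrite addeNy leNye.
set w := fine (W1 mu nu).
have [t sub_t] := convex_subgradient w Phi_convex.
(* [t] is a slope of a nondecreasing function. *)
have t_ge0 : 0 <= t.
  have := sub_t (w - 1).
  have : Phi (w - 1) <= Phi w by apply: Phi_increasing; lra.
  by lra.
have dual (f : X -> R) : Lipschitz1 f ->
    (t%:E * (\int[nu]_x (f x)%:E - \int[mu]_x (f x)%:E) - (t * w - Phi w)%:E
     <= phi mu)%E.
  move=> f1; rewrite -(legendre_subgradient sub_t).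
  by have /(rho_le0P t nu phiNy (LNy t) f1) := rho_le0 f t f1; exact.
case: (phi mu) (phiNy mu) dual => [r _ dual|_ _|//]; last exact: leey.
rewrite lee_fin; have [t0|tn0] := eqVneq t 0.
  have c1 : Lipschitz1 (fun _ : X => 0 : R).
    by apply/Lipschitz1P => x y; rewrite subrr normr0 mdist_ge0.
  have := dual _ c1; have [z -> _] := gapE _ mu c1.
  by rewrite t0 -EFinM -EFinB lee_fin; lra.
have t_gt0 : 0 < t by rewrite lt_neqAle eq_sym tn0.
(* [dual] bounds the gain of every 1-Lipschitz function; the duality turns this
   into a bound on the distance, which is the claim at the point of tangency
   [w]. *)
have : (W1 mu nu <= ((r + (t * w - Phi w)) / t)%:E)%E.
  apply: W1_le_Lipschitz1_gap => // f f1.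
  have := dual f f1; have [z -> _] := gapE f mu f1.
  by rewrite -EFinM -EFinB !lee_fin ler_pdivlMr// lerBlDr mulrC.
rewrite -(fineK (W1_fin_num mu nu X_separable)) -/w lee_fin ler_pdivlMr//.
by lra.
Qed.
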